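(* Let $(L,A,[\cdot,\cdot,\cdot],\rho)$ be a $3$-Lie-Rinehart superalgebra and $E=L\oplus A=\{(x,a)\mid x\in L,\ a\in A\}$, graded by $E_{\overline 0}=L_{\overline 0}\oplus A_{\overline 0}$, $E_{\overline 1}=L_{\overline 1}\oplus A_{\overline 1}$. Equip $E$ with the operations, for homogeneous elements $(x,a),(y,b),(z,c)$ of $E$, $b'\in\mathcal H(A)$ and $k\in\mathbb K$, $$k(x,a)=(kx,ka),\qquad (x,a)+(y,b)=(x+y,a+b),\qquad b'(x,a)=(b'x,b'a),$$ $$[(x,a),(y,b),(z,c)]_1=\big([x,y,z],\ \rho(x,y)(c)-(-1)^{\bar y\bar z}\rho(x,z)(b)+(-1)^{\bar x(\bar y+\bar z)}\rho(y,z)(a)\big),$$ and the map $$\rho_1:E\wedge E\to Der(A),\qquad \rho_1((x,a),(y,b))=\rho(x,y).$$ Then $(E,A,[\cdot,\cdot,\cdot]_1,\rho_1)$ is a $3$-Lie-Rinehart superalgebra.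
   Context: $\mathbb K$ is the base field; all vector spaces are $\mathbb Z_2$-graded, $\bar v$ is the degree of a homogeneous element $v$, and $\mathcal H(V)$ is the set of homogeneous elements of $V$. $Der(A)$ is the space of superderivations of $A$. In all identities the elements are homogeneous; a homogeneous element $(x,a)$ of $E$ has $\bar x=\bar a$. 3-Lie superalgebra: $\mathbb Z_2$-graded space $\mathfrak g$ with an even trilinear bracket such that $[x,y,z]=-(-1)^{\bar x\bar y}[y,x,z]$, $[x,y,z]=-(-1)^{\bar y\bar z}[x,z,y]$ and $[x,y,[z,u,v]]=[[x,y,z],u,v]+(-1)^{\bar z(\bar x+\bar y)}[z,[x,y,u],v]+(-1)^{(\bar z+\bar u)(\bar x+\bar y)}[z,u,[x,y,v]]$. Representation of a 3-Lie superalgebra $\mathfrak g$ on a graded space $V$: an even linear map $\rho:\mathfrak g\wedge\mathfrak g\to\mathfrak{gl}(V)$ with $\rho(x_1,x_2)\rho(x_3,x_4)-(-1)^{(\bar x_1+\bar x_2)(\bar x_3+\bar x_4)}\rho(x_3,x_4)\rho(x_1,x_2)=\rho([x_1,x_2,x_3],x_4)-(-1)^{\bar x_3\bar x_4}\rho([x_1,x_2,x_4],x_3)$ and $\rho([x_1,x_2,x_3],x_4)=\rho(x_1,x_2)\rho(x_3,x_4)+(-1)^{\bar x_1(\bar x_2+\bar x_3)}\rho(x_2,x_3)\rho(x_1,x_4)+(-1)^{\bar x_3(\bar x_1+\bar x_2)}\rho(x_3,x_1)\rho(x_2,x_4)$. 3-Lie-Rinehart superalgebra $(L,A,[\cdot,\cdot,\cdot],\rho)$: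 $A$ is an associative supercommutative superalgebra over $\mathbb K$, $L$ an $A$-module, $(L,[\cdot,\cdot,\cdot])$ a 3-Lie superalgebra, $\rho:L\times L\to Der(A)$ a representation of it on $A$, such that $\rho(ax,y)=(-1)^{\bar a\bar x}\rho(x,ay)=a\rho(x,y)$ and $[x,y,az]=(-1)^{\bar a(\bar x+\bar y)}a[x,y,z]+\rho(x,y)(a)\,z$. *)

(* Defs.v *)
From HB Require Import structures.
From mathcomp Require Import all_boot all_order all_algebra.

Set Implicit Arguments.
Unset Strict Implicit.
Unset Printing Implicit Defensive.

Import GRing.Theory.
Local Open Scope ring_scope.

(* Z_2-graded vector spaces V = V_0 (+) V_1. Degrees are booleans (false for
   even, true for odd): [(+)] adds them, and coercing them to nat makes the
   Koszul signs (-1) ^+ (i * j) meaningful. The zero vector has both degrees. *)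
Record superspace (K : fieldType) := Superspace {
  sspace :> lmodType K;
  homog : bool -> {pred sspace};
  homog_submod : forall i, submod_closed (homog i);
  homog_sum : forall v, exists u,
    (u \in homog false) && (v - u \in homog true);
  homog_cap : forall v, v \in homog false -> v \in homog true -> v = 0
}.

Arguments homog {K} V i : rename.
Arguments homog_submod {K} V i : rename.
Arguments homog_sum {K} V v : rename.

Section Parts.
Variables (K : fieldType) (V : superspace K).

Definition even_part (v : V) : V := xchoose (homog_sum V v).

Definition part (i : bool) (v : V) : V :=
  if i then v - even_part v else even_part v.

Lemma part_homog i v : part i v \in homog V i.
Proof.
by have /andP[h0 h1] := xchooseP (homog_sum V v); case: i.
Qed.

Lemma part_sum v : part false v + part true v = v.
Proof. by rewrite /part addrC subrK. Qed.

Lemma homog0 i : 0 \in homog V i.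
Proof. by case: (homog_submod V i). Qed.

Lemma homogB i u v :
  u \in homog V i -> v \in homog V i -> u - v \in homog V i.
Proof.
move=> hu hv; have [_ /(_ (-1) v u hv hu)] := homog_submod V i.
by rewrite scaleN1r addrC.
Qed.

Lemma part_id i v : v \in homog V i -> part i v = v.
Proof.
move=> hv; apply/eqP; rewrite -subr_eq0; apply/eqP.
have h1 : part i v - v \in homog V i by apply: homogB; rewrite ?part_homog.
have h2 : part i v - v \in homog V (~~ i).
  have -> : part i v - v = 0 - part (~~ i) v.
    rewrite -{2}(part_sum v) opprD sub0r.
    by case: i {hv h1} => /=; [rewrite addrC subrK | rewrite addrA subrr add0r].
  by apply: homogB; rewrite ?homog0 ?part_homog.
by case: i h1 h2 {hv} => /= h1 h2; apply: homog_cap.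
Qed.

Lemma part_neq i v : v \in homog V i -> part (~~ i) v = 0.
Proof.
move=> hv; apply: (@addrI _ v); rewrite addr0.
rewrite -{1}(part_id hv) -[RHS]part_sum.
by case: i {hv} => //=; rewrite addrC.
Qed.

End Parts.

Section DirectSum.
Variables (K : fieldType) (V W : superspace K).

Definition dsum_homog (i : bool) : {pred (V * W)%type} :=
  fun u => (u.1 \in homog V i) && (u.2 \in homog W i).

Lemma dsum_submod i : submod_closed (dsum_homog i).
Proof.
split; first by rewrite unfold_in /dsum_homog /= !homog0.
move=> k u v; rewrite !unfold_in /dsum_homog /= => /andP[u1 u2] /andP[v1 v2].
have [_ HV] := homog_submod V i; have [_ HW] := homog_submod W i.
by apply/andP; split; [apply: HV | apply: HW].
Qed.

Lemma dsum_sum (v : V * W) : exists u,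
  (u \in dsum_homog false) && (v - u \in dsum_homog true).
Proof.
exists (part false v.1, part false v.2); rewrite !unfold_in /dsum_homog.
apply/andP; split; apply/andP; split.
- exact: (part_homog false v.1).
- exact: (part_homog false v.2).
- exact: (part_homog true v.1).
- exact: (part_homog true v.2).
Qed.

Lemma dsum_cap (v : V * W) :
  v \in dsum_homog false -> v \in dsum_homog true -> v = 0.
Proof.
case: v => x y; rewrite !unfold_in /dsum_homog /=.
move=> /andP[x0 y0] /andP[x1 y1].
by rewrite (homog_cap x0 x1) (homog_cap y0 y1).
Qed.

Definition dsum : superspace K :=
  @Superspace K (V * W)%type dsum_homog dsum_submod dsum_sum dsum_cap.

End DirectSum.

Section Structures.
Variable K : fieldType.

Definition bilinear2 (U V W : lmodType K) (f : U -> V -> W) : Prop :=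
  (forall y, linear (fun x => f x y)) /\ (forall x, linear (f x)).

Definition trilinear (U V W X : lmodType K) (f : U -> V -> W -> X) : Prop :=
  [/\ forall y z, linear (fun x => f x y z),
      forall x z, linear (fun y => f x y z) &
      forall x y, linear (f x y)].

(* No unit is required of A, nor unitality of its modules. *)
Record assoc_supercomm (A : superspace K) (mul : A -> A -> A) : Prop := {
  sc_bilin : bilinear2 mul;
  sc_even : forall i j a b, a \in homog A i -> b \in homog A j ->
    mul a b \in homog A (i (+) j);
  sc_assoc : forall a b c, mul (mul a b) c = mul a (mul b c);
  sc_comm : forall i j a b, a \in homog A i -> b \in homog A j ->
    mul a b = (-1) ^+ (i * j)%N *: mul b a
}.

Record supermodule (A : superspace K) (mul : A -> A -> A)
    (M : superspace K) (act : A -> M -> M) : Prop := {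
  sm_bilin : bilinear2 act;
  sm_even : forall i j a x, a \in homog A i -> x \in homog M j ->
    act a x \in homog M (i (+) j);
  sm_assoc : forall a b x, act (mul a b) x = act a (act b x)
}.

Definition superder (A : superspace K) (mul : A -> A -> A)
    (d : bool) (D : A -> A) : Prop :=
  [/\ linear D,
      forall i a, a \in homog A i -> D a \in homog A (d (+) i) &
      forall i j a b, a \in homog A i -> b \in homog A j ->
        D (mul a b) = mul (D a) b + (-1) ^+ (d * i)%N *: mul a (D b)].

(* Der(A) = Der(A)_0 (+) Der(A)_1 *)
Definition in_Der (A : superspace K) (mul : A -> A -> A) (D : A -> A) : Prop :=
  exists D0 D1, [/\ superder mul false D0, superder mul true D1 &
                    forall a, D a = D0 a + D1 a].

Record Lie3_super (L : superspace K) (br : L -> L -> L -> L) : Prop := {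
  l3_trilin : trilinear br;
  l3_even : forall i j k x y z,
    x \in homog L i -> y \in homog L j -> z \in homog L k ->
    br x y z \in homog L (i (+) j (+) k);
  l3_skew12 : forall i j k x y z,
    x \in homog L i -> y \in homog L j -> z \in homog L k ->
    br x y z = - ((-1) ^+ (i * j)%N *: br y x z);
  l3_skew23 : forall i j k x y z,
    x \in homog L i -> y \in homog L j -> z \in homog L k ->
    br x y z = - ((-1) ^+ (j * k)%N *: br x z y);
  l3_fundamental : forall i j k l m x y z u v,
    x \in homog L i -> y \in homog L j -> z \in homog L k ->
    u \in homog L l -> v \in homog L m ->
    br x y (br z u v) =
      br (br x y z) u v
      + (-1) ^+ (k * (i + j))%N *: br z (br x y u) v
      + (-1) ^+ ((k + l) * (i + j))%N *: br z u (br x y v)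
}.

Record Lie3_rep (L : superspace K) (br : L -> L -> L -> L)
    (V : superspace K) (rho : L -> L -> V -> V) : Prop := {
  r3_trilin : trilinear rho;
  r3_even : forall i j k x y v,
    x \in homog L i -> y \in homog L j -> v \in homog V k ->
    rho x y v \in homog V (i (+) j (+) k);
  r3_skew : forall i j x y v, x \in homog L i -> y \in homog L j ->
    rho x y v = - ((-1) ^+ (i * j)%N *: rho y x v);
  r3_comm : forall i1 i2 i3 i4 x1 x2 x3 x4 v,
    x1 \in homog L i1 -> x2 \in homog L i2 ->
    x3 \in homog L i3 -> x4 \in homog L i4 ->
    rho x1 x2 (rho x3 x4 v)
      - (-1) ^+ ((i1 + i2) * (i3 + i4))%N *: rho x3 x4 (rho x1 x2 v) =
    rho (br x1 x2 x3) x4 v - (-1) ^+ (i3 * i4)%N *: rho (br x1 x2 x4) x3 v;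
  r3_bracket : forall i1 i2 i3 i4 x1 x2 x3 x4 v,
    x1 \in homog L i1 -> x2 \in homog L i2 ->
    x3 \in homog L i3 -> x4 \in homog L i4 ->
    rho (br x1 x2 x3) x4 v =
      rho x1 x2 (rho x3 x4 v)
      + (-1) ^+ (i1 * (i2 + i3))%N *: rho x2 x3 (rho x1 x4 v)
      + (-1) ^+ (i3 * (i1 + i2))%N *: rho x3 x1 (rho x2 x4 v)
}.

Record Lie3_Rinehart_super (L A : superspace K) (mul : A -> A -> A)
    (act : A -> L -> L) (br : L -> L -> L -> L)
    (rho : L -> L -> A -> A) : Prop := {
  lr_alg : assoc_supercomm mul;
  lr_mod : supermodule mul act;
  lr_lie : Lie3_super br;
  lr_der : forall x y, in_Der mul (rho x y);
  lr_rep : Lie3_rep br rho;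
  lr_anchor_l : forall i j k a x y b,
    a \in homog A i -> x \in homog L j -> y \in homog L k ->
    rho (act a x) y b = mul a (rho x y b);
  lr_anchor_r : forall i j k a x y b,
    a \in homog A i -> x \in homog L j -> y \in homog L k ->
    (-1) ^+ (i * j)%N *: rho x (act a y) b = mul a (rho x y b);
  lr_leibniz : forall i j k l a x y z,
    a \in homog A i -> x \in homog L j -> y \in homog L k ->
    z \in homog L l ->
    br x y (act a z) =
      (-1) ^+ (i * (j + k))%N *: act a (br x y z) + act (rho x y a) z
}.

End Structures.

Section Semidirect.
Variables (K : fieldType) (L A : superspace K).
Variables (mul : A -> A -> A) (act : A -> L -> L).
Variables (br : L -> L -> L -> L) (rho : L -> L -> A -> A).

Definition act1 (b : A) (X : dsum L A) : dsum L A := (act b X.1, mul b X.2).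

(* The bracket of X, Y, Z homogeneous of respective degrees i, j, k. *)
Definition br1_homog (i j k : bool) (X Y Z : dsum L A) : dsum L A :=
  (br X.1 Y.1 Z.1,
   rho X.1 Y.1 Z.2 - (-1) ^+ (j * k)%N *: rho X.1 Z.1 Y.2
     + (-1) ^+ (i * (j + k))%N *: rho Y.1 Z.1 X.2).

(* Extension of [br1_homog] to arbitrary elements, by trilinearity. *)
Definition br1 (X Y Z : dsum L A) : dsum L A :=
  \sum_(i : bool) \sum_(j : bool) \sum_(k : bool)
    br1_homog i j k (part i X) (part j Y) (part k Z).

Definition rho1 (X Y : dsum L A) : A -> A := rho X.1 Y.1.

Lemma br1E i j k (X Y Z : dsum L A) : trilinear br -> trilinear rho ->
  X \in homog (dsum L A) i -> Y \in homog (dsum L A) j ->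
  Z \in homog (dsum L A) k ->
  br1 X Y Z = br1_homog i j k X Y Z.
Proof.
move=> [b1 b2 b3] [r1 r2 r3] hX hY hZ.
have lin0 (U V : lmodType K) (f : U -> V) : linear f -> f 0 = 0.
  by move=> lf; have := lf (-1) 0 0; rewrite scaler0 addr0 scaleN1r addNr.
have b0 := (fun y z => lin0 _ _ _ (b1 y z), fun x z => lin0 _ _ _ (b2 x z),
            fun x y => lin0 _ _ _ (b3 x y)).
have r0 := (fun y z => lin0 _ _ _ (r1 y z), fun x z => lin0 _ _ _ (r2 x z),
            fun x y => lin0 _ _ _ (r3 x y)).
have z1 p q r y z : br1_homog p q r 0 y z = 0.
  by rewrite /br1_homog /= !(b0, r0) !(scaler0, subr0, addr0).
have z2 p q r x z : br1_homog p q r x 0 z = 0.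
  by rewrite /br1_homog /= !(b0, r0) !(scaler0, subr0, addr0).
have z3 p q r x y : br1_homog p q r x y 0 = 0.
  by rewrite /br1_homog /= !(b0, r0) !(scaler0, subr0, addr0).
have pneq (p q : bool) (V : superspace K) (v : V) :
    v \in homog V p -> q != p -> part q v = 0.
  by move=> hv; case: q p hv => [] [] // hv _; apply: (part_neq hv).
rewrite /br1 (bigD1 i) //= [X in _ + X]big1 ?addr0; last first.
  move=> p np; rewrite (pneq _ _ _ _ hX np).
  by do 2!(apply: big1 => ? _).
rewrite (bigD1 j) //= [X in _ + X]big1 ?addr0; last first.
  by move=> p np; rewrite (pneq _ _ _ _ hY np); apply: big1 => ? _.
rewrite (bigD1 k) //= [X in _ + X]big1 ?addr0; last first.
  by move=> p np; rewrite (pneq _ _ _ _ hZ np).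
by rewrite (part_id hX) (part_id hY) (part_id hZ).
Qed.

End Semidirect.

(* Main.v *)
(* [.,.,.]_1 is the semidirect bracket of L by the representation rho on A, so
   each axiom splits into its L-component, which is the axiom for L, and an
   A-component which is additive in the elements of A. In the fundamental
   identity the terms containing an entry v, u or z in A from the inner bracket
   say that rho(x,y) acts as a derivation on rho(.,.), and those containing an
   entry x or y say how rho expands on a bracket: these are the two axioms of a
   representation up to skew-symmetry. The Leibniz rule holds because for
   homogeneous x, y the map rho(x,y) is a superderivation of degree |x| + |y|. *)
Require Import Defs.
From mathcomp Require Import all_boot all_order all_algebra.

Set Implicit Arguments.
Unset Strict Implicit.
Unset Printing Implicit Defensive.

Import GRing.Theory.
Local Open Scope ring_scope.

(** * Maps known only through the predicate [linear] *)

Section LinearFunctions.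
Variables (K : fieldType) (U V : lmodType K) (f : U -> V).
Hypothesis lf : linear f.

Lemma linear_funD u v : f (u + v) = f u + f v.
Proof. by have := lf 1 u v; rewrite !scale1r. Qed.

Lemma linear_fun0 : f 0 = 0.
Proof. by apply: (@addrI _ (f 0)); rewrite -linear_funD !addr0. Qed.

Lemma linear_funZ k u : f (k *: u) = k *: f u.
Proof. by rewrite -[k *: u]addr0 lf linear_fun0 addr0. Qed.

Lemma linear_funN u : f (- u) = - f u.
Proof. by rewrite -scaleN1r linear_funZ scaleN1r. Qed.

End LinearFunctions.

(** Turns each Koszul sign into a boolean test on the degrees, so that sign bookkeeping becomes a
    case analysis on the degree bits. *)
Lemma scale_sign (K : fieldType) (V : lmodType K) n (v : V) :
  (-1) ^+ n *: v = if odd n then - v else v.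
Proof. by rewrite -signr_odd; case: odd; rewrite ?scaleN1r ?scale1r. Qed.

(** * Homogeneous elements and components *)

Section Homogeneous.
Variables (K : fieldType) (V : superspace K).

Lemma homogP i k (u v : V) :
  u \in homog V i -> v \in homog V i -> k *: u + v \in homog V i.
Proof. by have [_ hP] := homog_submod V i; apply: hP. Qed.

Lemma homogZ i k (u : V) : u \in homog V i -> k *: u \in homog V i.
Proof. by move=> hu; rewrite -[k *: u]addr0 homogP ?homog0. Qed.

Lemma homogD i (u v : V) :
  u \in homog V i -> v \in homog V i -> u + v \in homog V i.
Proof. by move=> hu hv; rewrite -[u]scale1r homogP. Qed.

(** [even_part] is a mere choice, so linearity rests on uniqueness of the decomposition: the defects
    [d j] of the two parts have opposite degrees and sum to 0, hence each has both degrees and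
    vanishes. *)
Lemma part_linear i : linear (@part K V i).
Proof.
move=> k u v; apply/eqP; rewrite -subr_eq0; apply/eqP.
pose d j := part j (k *: u + v) - (k *: part j u + part j v).
have dh j : d j \in homog V j.
  by apply: homogB; rewrite ?homogP ?part_homog.
have d0 : d false + d true = 0.
  rewrite /d addrACA -opprD addrACA -scalerDr !part_sum.
  exact: subrr.
have dN : d i = 0 - d (~~ i).
  rewrite sub0r; apply/eqP; rewrite -addr_eq0; apply/eqP.
  by case: i; rewrite //= addrC.
have h' : d i \in homog V (~~ i) by rewrite dN homogB ?homog0.
by rewrite -/(d i); case: i {dN} h' (dh i) => h' h; apply: homog_cap.
Qed.

End Homogeneous.

Lemma in_dsum (K : fieldType) (V W : superspace K) i (u : dsum V W) :
  (u \in homog (dsum V W) i) = (u.1 \in homog V i) && (u.2 \in homog W i).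
Proof. by []. Qed.

Lemma dsum_eq (K : fieldType) (V W : superspace K) (u v : dsum V W) :
  u.1 = v.1 -> u.2 = v.2 -> u = v.
Proof. by case: u v => [u1 u2] [v1 v2] /= -> ->. Qed.

(* Comparing degrees kills the component of the wrong parity. *)
Lemma in_Der_homog (K : fieldType) (A : superspace K) (mul : A -> A -> A)
    d (D : A -> A) :
  in_Der mul D ->
  (forall i a, a \in homog A i -> D a \in homog A (d (+) i)) ->
  superder mul d D.
Proof.
move=> [D0 [D1 [h0 h1 eD]]] hD.
pose E b := if b then D1 else D0.
have hE b : superder mul b (E b) by case: b.
have {}eD a : D a = E d a + E (~~ d) a.
  by rewrite eD; case: d {hD}; rewrite //= addrC.
have Ez i a : a \in homog A i -> E (~~ d) a = 0.
  move=> ha; have [_ eN _] := hE (~~ d); have [_ eP _] := hE d.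
  have h : E (~~ d) a \in homog A (d (+) i).
    have -> : E (~~ d) a = D a - E d a by rewrite eD addrC addKr.
    by apply: homogB; [apply: hD | apply: eP].
  have h' := eN _ _ ha; rewrite addNb in h'.
  by case: (d (+) i) h h' => h h'; apply: homog_cap.
have lN : linear (E (~~ d)) by case: (hE (~~ d)).
have eq_D a : D a = E d a.
  rewrite eD -(part_sum a) (linear_funD lN).
  by rewrite !(Ez _ _ (part_homog _ _)) !addr0.
have [l _ m] := hE d; split=> // [k u v|i j a b ha hb]; rewrite !eq_D.
  exact: l.
exact: (m i j).
Qed.

(** * Derivation and representation identities for [rho] *)

Section Rinehart.
Variables (K : fieldType) (L A : superspace K).
Variables (mul : A -> A -> A) (act : A -> L -> L).
Variables (br : L -> L -> L -> L) (rho : L -> L -> A -> A).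
Hypothesis HL : Lie3_Rinehart_super mul act br rho.

Let trho : trilinear rho := r3_trilin (lr_rep HL).
Let tbr : trilinear br := l3_trilin (lr_lie HL).

Let rho_l y z : linear (fun x => rho x y z). Proof. by case: trho. Qed.
Let rho_m x z : linear (fun y => rho x y z). Proof. by case: trho. Qed.
Let rho_r x y : linear (rho x y). Proof. by case: trho. Qed.

(** [lr_der] gives only a sum of an even and an odd superderivation; the evenness of [rho] selects
    the degree that fixes the sign in the Leibniz rule. *)
Lemma rho_superder i j x y :
  x \in homog L i -> y \in homog L j -> superder mul (i (+) j) (rho x y).
Proof.
move=> hx hy; apply: in_Der_homog (lr_der HL x y) _ => k a ha.
exact: (r3_even (lr_rep HL)).
Qed.

(** The commutator axiom [r3_comm] in the shape of the fundamental identity, with [br x y u] moved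
    to the second slot by skew-symmetry. *)
Lemma rho_derivation i j k l x y z u w :
  x \in homog L i -> y \in homog L j -> z \in homog L k -> u \in homog L l ->
  rho x y (rho z u w) =
    rho (br x y z) u w + (-1) ^+ (k * (i + j))%N *: rho z (br x y u) w
    + (-1) ^+ ((k + l) * (i + j))%N *: rho z u (rho x y w).
Proof.
move=> hx hy hz hu; have hb := l3_even (lr_lie HL) hx hy hu.
have /(canRL (subrK _)) -> := r3_comm (lr_rep HL) w hx hy hz hu.
rewrite (r3_skew (lr_rep HL) w hz hb) !scale_sign !(oddM, oddD, oddb).
by case: i j k l {hx hy hz hu hb} => [] [] [] []; rewrite /= ?opprK.
Qed.

(** The axiom [r3_bracket] with the bracket moved to the second slot and the arguments of each [rho]
    reordered by skew-symmetry, to match the terms of nested brackets [br1]. *)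
Lemma rho_bracket_r i k l m x z u v w :
  x \in homog L i -> z \in homog L k -> u \in homog L l -> v \in homog L m ->
  rho x (br z u v) w =
    (-1) ^+ (i * (k + l))%N *: rho z u (rho x v w)
    - (-1) ^+ (i * (k + m) + l * m)%N *: rho z v (rho x u w)
    + (-1) ^+ ((k + i) * (l + m))%N *: rho u v (rho x z w).
Proof.
move=> hx hz hu hv; have hb := l3_even (lr_lie HL) hz hu hv.
rewrite (r3_skew (lr_rep HL) w hx hb) (r3_bracket (lr_rep HL) w hz hu hv hx).
rewrite (r3_skew (lr_rep HL) w hz hx) (r3_skew (lr_rep HL) w hu hx).
rewrite (r3_skew (lr_rep HL) w hv hx) (r3_skew (lr_rep HL) _ hv hz).
rewrite !(linear_funN (rho_r _ _)) !(linear_funZ (rho_r _ _)).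
rewrite !scale_sign !(oddM, oddD, oddb) [RHS]addrAC.
case: i k l m {hx hz hu hv hb} => [] [] [] [] /=;
  by rewrite !(opprD, opprK).
Qed.

(** * The 3-Lie superalgebra axioms on [dsum L A] *)

Lemma br1_homog_trilinear i j k : trilinear (br1_homog br rho i j k).
Proof.
have [b1 b2 b3] := tbr.
have swap c n (w : A) : c *: ((-1) ^+ n *: w) = (-1) ^+ n *: (c *: w).
  by rewrite !scalerA mulrC.
split=> [Y Z|X Z|X Y] c U V; apply: (@dsum_eq K L A) => /=;
  rewrite ?b1 ?b2 ?b3 // ?rho_l ?rho_m ?rho_r;
  rewrite !(scalerDr, scalerBr, scalerN, opprD, swap);
  (* Each of the three summands has split in two; the multiples of [c] are the odd positions. *)
  by rewrite [LHS](AC ((2*2)*2) ((1*3*5)*(2*4*6))).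
Qed.

(** In [br1_homog] the degrees are mere sign parameters, so it is trilinear on all of [dsum L A];
    composing with the linear maps [part] and summing preserves this. *)
Lemma br1_trilinear : trilinear (br1 br rho).
Proof.
split=> [Y Z|X Z|X Y] c U V; rewrite /br1 scaler_sumr -big_split;
  apply: eq_bigr => i _; rewrite scaler_sumr -big_split;
  apply: eq_bigr => j _; rewrite scaler_sumr -big_split;
  apply: eq_bigr => k _; rewrite part_linear;
  by have [l1 l2 l3] := br1_homog_trilinear i j k; rewrite ?l1 ?l2 ?l3.
Qed.

Let br1H i j k X Y Z : X \in homog (dsum L A) i -> Y \in homog (dsum L A) j ->
  Z \in homog (dsum L A) k -> br1 br rho X Y Z = br1_homog br rho i j k X Y Z.
Proof. exact: br1E tbr trho. Qed.

Lemma br1_even i j k X Y Z :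
  X \in homog (dsum L A) i -> Y \in homog (dsum L A) j ->
  Z \in homog (dsum L A) k ->
  br1 br rho X Y Z \in homog (dsum L A) (i (+) j (+) k).
Proof.
move=> hX hY hZ; rewrite (br1H hX hY hZ).
move: hX hY hZ; rewrite !in_dsum => /andP[x a] /andP[y b] /andP[z c].
have rho_even := r3_even (lr_rep HL).
apply/andP; split; first exact: (l3_even (lr_lie HL)).
apply: homogD; last by apply: homogZ; rewrite -addbA addbC; exact: rho_even.
apply: homogB; first exact: rho_even.
by apply: homogZ; rewrite addbAC; exact: rho_even.
Qed.

Lemma br1_skew12 i j k X Y Z :
  X \in homog (dsum L A) i -> Y \in homog (dsum L A) j ->
  Z \in homog (dsum L A) k ->
  br1 br rho X Y Z = - ((-1) ^+ (i * j)%N *: br1 br rho Y X Z).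
Proof.
move=> hX hY hZ; rewrite (br1H hX hY hZ) (br1H hY hX hZ).
move: hX hY hZ; rewrite !in_dsum => /andP[x a] /andP[y b] /andP[z c].
apply: (@dsum_eq K L A); first exact: (l3_skew12 (lr_lie HL) x y z).
rewrite /= (r3_skew (lr_rep HL) Z.2 x y) !scale_sign !(oddM, oddD, oddb).
case: i j k {x a y b z c} => [] [] [] /=;
  by rewrite !(opprD, opprK) addrAC.
Qed.

Lemma br1_skew23 i j k X Y Z :
  X \in homog (dsum L A) i -> Y \in homog (dsum L A) j ->
  Z \in homog (dsum L A) k ->
  br1 br rho X Y Z = - ((-1) ^+ (j * k)%N *: br1 br rho X Z Y).
Proof.
move=> hX hY hZ; rewrite (br1H hX hY hZ) (br1H hX hZ hY).
move: hX hY hZ; rewrite !in_dsum => /andP[x a] /andP[y b] /andP[z c].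
apply: (@dsum_eq K L A); first exact: (l3_skew23 (lr_lie HL) x y z).
rewrite /= (r3_skew (lr_rep HL) X.2 y z) !scale_sign !(oddM, oddD, oddb).
case: i j k {x a y b z c} => [] [] [] /=;
  by rewrite !(opprD, opprK) [X in X + _]addrC.
Qed.

Lemma br1_fundamental i j k l m X Y Z U V :
  X \in homog (dsum L A) i -> Y \in homog (dsum L A) j ->
  Z \in homog (dsum L A) k -> U \in homog (dsum L A) l ->
  V \in homog (dsum L A) m ->
  br1 br rho X Y (br1 br rho Z U V) =
    br1 br rho (br1 br rho X Y Z) U V
    + (-1) ^+ (k * (i + j))%N *: br1 br rho Z (br1 br rho X Y U) V
    + (-1) ^+ ((k + l) * (i + j))%N *: br1 br rho Z U (br1 br rho X Y V).
Proof.
move=> hX hY hZ hU hV.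
(* The outer brackets are expanded first: by [br1_even] their inner brackets are homogeneous. *)
rewrite (br1H hX hY (br1_even hZ hU hV)) (br1H (br1_even hX hY hZ) hU hV).
rewrite (br1H hZ (br1_even hX hY hU) hV) (br1H hZ hU (br1_even hX hY hV)).
rewrite (br1H hZ hU hV) (br1H hX hY hZ) (br1H hX hY hU) (br1H hX hY hV).
move: hX hY hZ hU hV; rewrite !in_dsum.
move=> /andP[x _] /andP[y _] /andP[z _] /andP[u _] /andP[v _].
apply: (@dsum_eq K L A); first exact: (l3_fundamental (lr_lie HL) x y z u v).
rewrite /= !(linear_funD (rho_r _ _)) !(linear_funN (rho_r _ _)).
rewrite !(linear_funZ (rho_r _ _)).
(* The left side has one term for each of the five arguments in A, and each expands into three. *)
rewrite (rho_derivation V.2 x y z u) (rho_derivation U.2 x y z v).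
rewrite (rho_derivation Z.2 x y u v) (rho_bracket_r Y.2 x z u v).
rewrite (rho_bracket_r X.2 y z u v).
rewrite !scale_sign !(oddM, oddD, oddb).
(* Each argument of A gives three terms on the right, one per outer bracket:
   regroup by bracket the 15 terms grouped by argument. *)
case: i j k l m {x y z u v} => [] [] [] [] [] /=;
  rewrite !(opprD, opprK);
  by rewrite [LHS](AC (3*3*3*3*3)
    ((1*4*(9*12*15))*(2*(6*11*14)*7)*(3*10*13*5*8))).
Qed.

(** * Representation, module structure and Leibniz rule on [dsum L A] *)

Lemma rho1_rep : Lie3_rep (br1 br rho) (rho1 rho : dsum L A -> dsum L A -> _).
Proof.
have R := lr_rep HL.
split.
- split=> [Y a|X a|X Y]; rewrite /rho1 => c U V /=; first exact: rho_l.
    exact: rho_m.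
  exact: rho_r.
- move=> i j k X Y a; rewrite !in_dsum => /andP[x _] /andP[y _].
  exact: (r3_even R).
- move=> i j X Y a; rewrite !in_dsum => /andP[x _] /andP[y _].
  exact: (r3_skew R).
- move=> i1 i2 i3 i4 X1 X2 X3 X4 a h1 h2 h3 h4.
  (* [rho1] sees only L-components, and [br1H] shows that of [br1] to be [br]. *)
  rewrite (br1H h1 h2 h3) (br1H h1 h2 h4); move: h1 h2 h3 h4.
  rewrite !in_dsum => /andP[x1 _] /andP[x2 _] /andP[x3 _] /andP[x4 _].
  exact: (r3_comm R a x1 x2 x3 x4).
- move=> i1 i2 i3 i4 X1 X2 X3 X4 a h1 h2 h3 h4.
  rewrite (br1H h1 h2 h3); move: h1 h2 h3 h4.
  rewrite !in_dsum => /andP[x1 _] /andP[x2 _] /andP[x3 _] /andP[x4 _].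
  exact: (r3_bracket R a x1 x2 x3 x4).
Qed.

Lemma act1_supermodule : supermodule mul (act1 mul act : A -> dsum L A -> _).
Proof.
have [[ml mr] me ma _] := lr_alg HL; have [[al ar] ae aa] := lr_mod HL.
split.
- split=> [X|a] c u v; apply: (@dsum_eq K L A) => /=;
    by rewrite ?al ?ar ?ml ?mr.
- move=> i j a X ha; rewrite !in_dsum => /andP[x b] /=.
  by rewrite (ae _ _ _ _ ha x) (me _ _ _ _ ha b).
- by move=> a b X; apply: (@dsum_eq K L A); rewrite /= ?aa ?ma.
Qed.

Lemma rho_act_r i j k a x y w :
  a \in homog A i -> x \in homog L j -> y \in homog L k ->
  rho x (act a y) w = (-1) ^+ (i * j)%N *: mul a (rho x y w).
Proof.
move=> ha hx hy; rewrite -(lr_anchor_r HL w ha hx hy).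
by rewrite scalerA -expr2 sqrr_sign scale1r.
Qed.

Lemma br1_leibniz i j k l a X Y Z :
  a \in homog A i -> X \in homog (dsum L A) j -> Y \in homog (dsum L A) k ->
  Z \in homog (dsum L A) l ->
  br1 br rho X Y (act1 mul act a Z) =
    (-1) ^+ (i * (j + k))%N *: act1 mul act a (br1 br rho X Y Z)
    + act1 mul act (rho1 rho X Y a) Z.
Proof.
move=> ha hX hY hZ.
have [[_ mul_r] _ _ _] := lr_alg HL.
rewrite (br1H hX hY (sm_even act1_supermodule ha hZ)) (br1H hX hY hZ).
move: hX hY hZ; rewrite !in_dsum => /andP[x _] /andP[y _] /andP[z c].
apply: (@dsum_eq K L A); first exact: (lr_leibniz HL ha x y z).
(* Of the two terms of this product rule, [mul (rho X.1 Y.1 a) Z.2] is the A-component of the anchor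
   term; the other belongs to the bracket multiplied by [a]. *)
have [_ _ rhoM] := rho_superder x y.
rewrite /= (rhoM _ _ _ _ ha c) (rho_act_r Y.2 ha x z) (rho_act_r X.2 ha y z).
rewrite !(linear_funD (mul_r _)) !(linear_funN (mul_r _)).
rewrite !(linear_funZ (mul_r _)) !scale_sign !(oddM, oddD, oddb).
case: i j k l {ha x y z c rhoM} => [] [] [] [] /=; rewrite ?(opprD, opprK);
  by rewrite [LHS](AC (2*1*1) ((2*3*4)*1)).
Qed.

End Rinehart.

Theorem theorem2p7 (K : fieldType) (L A : superspace K)
    (mul : A -> A -> A) (act : A -> L -> L)
    (br : L -> L -> L -> L) (rho : L -> L -> A -> A)
    (HL : Lie3_Rinehart_super mul act br rho) :
  @Lie3_Rinehart_super K (dsum L A) A mul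
    (act1 mul act) (br1 br rho) (rho1 rho).
Proof.
split.
- exact: (lr_alg HL).
- exact: act1_supermodule HL.
- split.
  + exact: br1_trilinear HL.
  + exact: br1_even HL.
  + exact: br1_skew12 HL.
  + exact: br1_skew23 HL.
  + exact: br1_fundamental HL.
- move=> X Y; exact: (lr_der HL).
- exact: rho1_rep HL.
- move=> i j k a X Y b ha; rewrite !in_dsum => /andP[x _] /andP[y _].
  exact: (lr_anchor_l HL b ha x y).
- move=> i j k a X Y b ha; rewrite !in_dsum => /andP[x _] /andP[y _].
  exact: (lr_anchor_r HL b ha x y).
- exact: br1_leibniz HL.
Qed.
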